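(* Let $K$ be a field with algebraic closure $\overline{K}$, and let $f_1,f_2\in K[x]$ be nonconstant. If there is a subset $A$ of $\overline{K}$ that is both compatible and consistent (with respect to $f_1,f_2$), then $f_1$ and $f_2$ have a common composite over $K$. Explicitly, if $\ell:A\to\mathbb{Z}$ is a consistent labeling on $A$, then $h:=\prod_{a\in A}(x-a)^{\ell(a)}$ is a common composite of $f_1$ and $f_2$ over $\overline{K}$.
   Context: For a field $F$, nonconstant polynomials $f_1,f_2\in F[x]$ have a common composite over $F$ if there are nonconstant $u,v\in F[x]$ with $u(f_1(x))=v(f_2(x))$; any such polynomial $u(f_1(x))$ is a common composite over $F$. For $a\in\overline{K}$ and $i\in\{1,2\}$, $m_i(a)$ is the ramification index of $x=a$ in $\overline{K}(x)/\overline{K}(f_i(x))$, i.e. the multiplicity of $x=a$ as a root of $f_i(x)-f_i(a)$. An $f_i$-fiber is a set of the form $\{b\in\overline{K}: f_i(b)=f_i(a)\}$ with $a\in\overline{K}$. A nonempty finite subset of $\overline{K}$ is compatible if it is simultaneously a union of $f_1$-fibers and a union of $f_2$-fibers. A subset $A\subseteq\overline{K}$ is consistent if there is a function $\ell$ on $A$ (called a consistent labeling on $A$) such that (1) for each $a\in A$, $\ell(a)$ is a positive integer multiple of both $m_1(a)$ and $m_2(a)$; and (2) for $a,b\in A$ and $i\in\{1,2\}$, if $f_i(a)=f_i(b)$ then $\ell(a)/m_i(a)=\ell(b)/m_i(b)$. *)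

(* Defs.v *)
From HB Require Import structures.
From mathcomp Require Import all_boot all_order all_algebra.
From mathcomp Require Import boolp classical_sets cardinality fsbigop.

Set Implicit Arguments.
Unset Strict Implicit.
Unset Printing Implicit Defensive.

Import Order.TTheory GRing.Theory Num.Theory.
Local Open Scope classical_set_scope.
Local Open Scope ring_scope.

(* As L : closedFieldType is algebraically closed, this says that L is an
   algebraic closure of K via the embedding iota. *)
Definition is_algebraic_closure (K : fieldType) (L : closedFieldType)
    (iota : {rmorphism K -> L}) : Prop :=
  forall x : L, algebraicOver iota x.

Definition nonconstant (F : fieldType) (p : {poly F}) : Prop :=
  (1 < size p)%N.

Definition is_common_composite (F : fieldType) (f1 f2 h : {poly F}) : Prop :=
  exists u v : {poly F},
    [/\ nonconstant u, nonconstant v, h = u \Po f1 & h = v \Po f2].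

Definition has_common_composite (F : fieldType) (f1 f2 : {poly F}) : Prop :=
  exists h : {poly F}, is_common_composite f1 f2 h.

(* The ramification index of x = a in L(x)/L(f(x)). *)
Definition ram_index (L : fieldType) (f : {poly L}) (a : L) : nat :=
  mup a (f - (f.[a])%:P).

Definition fiber (L : fieldType) (f : {poly L}) (a : L) : set L :=
  [set b | f.[b] = f.[a]].

Definition is_union_of_fibers (L : fieldType) (f : {poly L}) (A : set L) : Prop :=
  exists S : set L, A = \bigcup_(a in S) fiber f a.

Definition compatible (L : fieldType) (f1 f2 : {poly L}) (A : set L) : Prop :=
  [/\ A !=set0, finite_set A, is_union_of_fibers f1 A & is_union_of_fibers f2 A].

(* A labeling of A is a total function whose values outside A are irrelevant.
   By condition (1) the integer divisions in condition (2) are exact. *)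
Definition consistent_labeling (L : fieldType) (f1 f2 : {poly L}) (A : set L)
    (l : L -> int) : Prop :=
  (forall a : L, A a ->
     [/\ 0 < l a, ((ram_index f1 a)%:Z %| l a)%Z
       & ((ram_index f2 a)%:Z %| l a)%Z]) /\
  (forall f : {poly L}, f = f1 \/ f = f2 ->
     forall a b : L, A a -> A b -> f.[a] = f.[b] ->
       (l a %/ (ram_index f a)%:Z)%Z = (l b %/ (ram_index f b)%:Z)%Z).

Definition consistent (L : fieldType) (f1 f2 : {poly L}) (A : set L) : Prop :=
  exists l : L -> int, consistent_labeling f1 f2 A l.

(* The power has an integer exponent; it is an ordinary polynomial power when
   l is positive on A. *)
Definition labeling_poly (L : fieldType) (A : set L) (l : L -> int) : {poly L} :=
  \big[*%R/1]_(a \in A) ('X - a%:P) ^ (l a).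

(* Main.v *)
Require Import Defs.
From mathcomp Require Import all_boot all_order all_algebra.
From mathcomp Require Import boolp classical_sets cardinality fsbigop.

(** Over the algebraically closed field, fix one of the two polynomials, [f].
    For a value [c] of [f] on [A], the whole fiber of [f] over [c] lies in [A],
    so [f - c] is, up to its leading coefficient, the product of the
    [(X - a) ^ m(a)] over the [a] in [A] with [f(a) = c]
    ([fiber_factorization]).  Consistency says that [l(a) = k(c) m(a)] with the
    same [k(c)] all along this fiber, so the part of the labeling polynomial
    living on the fiber is [((f - c) / lead_coef f) ^ k(c)], and the labeling
    polynomial is a polynomial in [f], namely the product of these powers
    composed with [f] ([prod_saturated_is_comp]).  Applying this to [f1] and to
    [f2] exhibits it as a common composite; it is nonconstant because [A] is
    nonempty and the labels are positive.

    Descending to the base field is linear algebra and holds for any field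
    extension ([has_common_composite_map]).  A relation [u(f1) = v(f2)],
    normalised by [u(0) = 0], is a linear dependence between the powers [f1^i]
    with [i > 0] and the powers [f2^j] with [j >= 0].  Polynomials over [K]
    that are dependent over an extension are already dependent over [K], since
    the rank of a matrix does not change under field extension.  A nontrivial
    dependence over [K] must have a nonzero coefficient on some [f1^i], because
    the powers of [f2] alone are independent; so the polynomial [u] that it
    gives is nonconstant. *)

Set Implicit Arguments.
Unset Strict Implicit.
Unset Printing Implicit Defensive.

Import Order.TTheory GRing.Theory Num.Theory.
Local Open Scope ring_scope.

(** * Linear dependence of polynomials under field extension *)

(** The number of columns is a parameter, rather than the largest size in the
    family, so that the matrix of the image of [p] in an extension is literally
    the image of the matrix of [p]. *)
Definition coef_mx (F : fieldType) (I : finType) (d : nat) (p : I -> {poly F}) :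
    'M[F]_(#|I|, d) :=
  \matrix_(i, j) (p (enum_val i))`_j.

Lemma poly_dependentP (F : fieldType) (I : finType) (d : nat)
    (p : I -> {poly F}) :
  (forall i, (size (p i) <= d)%N) ->
  (exists2 c : I -> F, exists i, c i != 0 & \sum_i c i *: p i = 0) <->
  ~~ row_free (coef_mx d p).
Proof.
move=> size_p; rewrite -kermx_eq0; split=> [[c [i0 ci0] sum0] | /rowV0Pn].
  apply/rowV0Pn; exists (\row_i c (enum_val i)).
    apply/sub_kermxP/rowP=> j; rewrite !mxE.
    have := congr1 (fun q : {poly F} => q`_j) sum0.
    rewrite coef0 coef_sum => sum0j; rewrite -[RHS]sum0j (reindex _ (onW_bij predT (@enum_val_bij I))) /=.
    by apply: eq_bigr => i _; rewrite !mxE coefZ.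
  apply/eqP=> /rowP/(_ (enum_rank i0)); rewrite !mxE enum_rankK.
  exact/eqP.
case=> w /sub_kermxP w0 /rV0Pn[k wk]; exists (fun i => w 0 (enum_rank i)).
  by exists (enum_val k); rewrite enum_valK.
apply/polyP=> j; rewrite coef0 coef_sum.
have [lt_jd | le_dj] := ltnP j d; last first.
  apply: big1 => i _; rewrite coefZ [(p i)`_j]nth_default ?mulr0 //.
  exact: leq_trans le_dj.
have := congr1 (fun M : 'rV_d => M 0 (Ordinal lt_jd)) w0.
rewrite !mxE => w0j; rewrite -[RHS]w0j (reindex _ (onW_bij predT (@enum_val_bij I))) /=.
by apply: eq_bigr => i _; rewrite coefZ !mxE enum_valK.
Qed.

Lemma poly_dependent_map (K L : fieldType) (iota : {rmorphism K -> L})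
    (I : finType) (p : I -> {poly K}) :
  (exists2 c : I -> L, exists i, c i != 0 &
     \sum_i c i *: map_poly iota (p i) = 0) ->
  exists2 c : I -> K, exists i, c i != 0 & \sum_i c i *: p i = 0.
Proof.
pose d := (\max_i size (p i))%N.
have size_p i : (size (p i) <= d)%N by exact: leq_bigmax.
have coef_mx_map : coef_mx d (fun i => map_poly iota (p i))
    = map_mx iota (coef_mx d p).
  by apply/matrixP=> i j; rewrite !mxE coef_map.
have size_Lp i : (size (map_poly iota (p i)) <= d)%N by rewrite size_map_poly.
move/(poly_dependentP size_Lp); rewrite coef_mx_map row_free_map.
by move/(poly_dependentP size_p).
Qed.

(** * Composition of polynomials *)

Lemma comp_poly_sumXn (F : fieldType) (n : nat) (c : 'I_n -> F) (q : {poly F}) :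
  (\sum_(i < n) c i *: 'X^i) \Po q = \sum_(i < n) c i *: q ^+ i.
Proof.
rewrite raddf_sum; apply: eq_bigr => i _ /=.
by rewrite comp_polyZ rmorphXn /= comp_polyX.
Qed.

Lemma sumXn_eq0 (F : fieldType) (n : nat) (c : 'I_n -> F) :
  \sum_(i < n) c i *: 'X^i = 0 :> {poly F} -> forall i, c i = 0.
Proof.
move=> c0 k; have := congr1 (fun q : {poly F} => q`_k) c0.
by rewrite coef0 coef_sumMXn (big_pred1 k).
Qed.

Lemma nonconstant_comp (F : fieldType) (u f : {poly F}) :
  nonconstant f -> nonconstant (u \Po f) = nonconstant u.
Proof.
rewrite /nonconstant => f_gt1; apply/propext.
have := size_comp_poly u f.
case: (size f) f_gt1 => [|[|n]] //= _.
case: (size u) => [|[|m]]; case: (size (u \Po f)) => [|[|k]] //=.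
Qed.

(** * Descent of common composites *)

(** A common composite over an extension yields a dependence, defined over the
    base field, between the [f1 ^+ i.+1] and the [f2 ^+ j].  Leaving out
    [f1 ^+ 0] removes the trivial relations between constants, so that any
    dependence which is left comes from a nonconstant [u]. *)
Lemma has_common_composite_map (K L : fieldType) (iota : {rmorphism K -> L})
    (f1 f2 : {poly K}) :
  nonconstant f1 -> nonconstant f2 ->
  has_common_composite (map_poly iota f1) (map_poly iota f2) ->
  has_common_composite f1 f2.
Proof.
move=> f1_nc f2_nc [_ [u [v [u_nc _ -> eq_uv]]]].
(* Normalise to u(0) = 0 by subtracting the constant term of u from both sides;
   u1 is then u divided by X. *)
pose u1 := drop_poly 1 u; pose w := v - (u`_0)%:P.
have def_u : u = u1 * 'X + (u`_0)%:P.
  rewrite -[u in LHS](poly_take_drop 1) addrC expr1; congr (_ + _).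
  by apply/polyP=> i; rewrite coef_take_poly coefC ltnS leqn0; case: eqP => [->|].
have comp_u q : u \Po q = (u1 \Po q) * q + (u`_0)%:P.
  rewrite [LHS](congr1 (comp_poly q) def_u) comp_polyD comp_polyM.
  by rewrite comp_polyX comp_polyC.
have u1_neq0 : u1 != 0.
  by rewrite -size_poly_gt0 size_drop_poly subn_gt0.
pose p (i : 'I_(size u1) + 'I_(size w)) : {poly K} :=
  match i with inl i => f1 ^+ i.+1 | inr j => f2 ^+ j end.
have [|c [k ck] sum0] := @poly_dependent_map K L iota _ p.
  pose c (i : 'I_(size u1) + 'I_(size w)) : L :=
    match i with inl i => u1`_i | inr j => - w`_j end.
  have lt_last : ((size u1).-1 < size u1)%N by rewrite prednK // size_poly_gt0.
  exists c.
    by exists (inl (Ordinal lt_last)); rewrite /= -lead_coefE lead_coef_eq0.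
  rewrite big_sumType /=.
  have -> : \sum_(i < size u1) u1`_i *: map_poly iota (f1 ^+ i.+1)
     = (u1 \Po map_poly iota f1) * map_poly iota f1.
    rewrite comp_polyE mulr_suml; apply: eq_bigr => i _.
    by rewrite rmorphXn /= exprSr scalerAl.
  have -> : \sum_(j < size w) - w`_j *: map_poly iota (f2 ^+ j)
     = - (w \Po map_poly iota f2).
    rewrite comp_polyE -sumrN; apply: eq_bigr => j _.
    by rewrite rmorphXn /= scaleNr.
  by rewrite comp_polyB comp_polyC -eq_uv comp_u addrK subrr.
pose U := \sum_(i < size u1) c (inl i) *: 'X^i.
pose V := \sum_(j < size w) c (inr j) *: 'X^j.
have eqUV : (U * 'X) \Po f1 = - V \Po f2.
  apply/eqP; rewrite -subr_eq0; apply/eqP; rewrite -[RHS]sum0 big_sumType /=.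
  rewrite comp_polyM comp_polyX [- V \Po f2]raddfN opprK /= !comp_poly_sumXn.
  rewrite mulr_suml; congr (_ + _); apply: eq_bigr => i _.
  by rewrite exprSr scalerAl.
(* If U vanished, so would V, as composition with f2 is injective. *)
have U_neq0 : U != 0.
  apply/eqP=> U0; have V0 : V = 0.
    apply/eqP; rewrite -oppr_eq0 -(comp_poly_eq0 (- V) f2_nc) -eqUV U0.
    by rewrite mul0r comp_poly0.
  case/eqP: ck; case: k => k.
    exact: (sumXn_eq0 U0 k).
  exact: (sumXn_eq0 V0 k).
have UX_nc : nonconstant (U * 'X).
  by rewrite /nonconstant size_mulX // ltnS size_poly_gt0.
exists ((U * 'X) \Po f1), (U * 'X), (- V); split=> //.
by rewrite -(nonconstant_comp (- V) f2_nc) -eqUV nonconstant_comp.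
Qed.

(** * Polynomials with prescribed zeros on fibers *)

(** Over an algebraically closed field, [f - c] is determined by its roots, and
    the multiplicity of such a root [a] is by definition the ramification index
    of [f] at [a], since [c] is [f.[a]]. *)
Lemma fiber_factorization (L : closedFieldType) (f : {poly L}) (c : L)
    (r : seq L) :
  nonconstant f -> uniq r -> (forall a, (a \in r) = (f.[a] == c)) ->
  f - c%:P = lead_coef f *: \prod_(a <- r) ('X - a%:P) ^+ ram_index f a.
Proof.
move=> f_nc r_uniq mem_r.
have lead_fc : lead_coef (f - c%:P) = lead_coef f.
  rewrite lead_coefDl // size_polyN.
  exact: leq_ltn_trans (size_polyC_leq1 c) f_nc.
have lead_neq0 : lead_coef f != 0.
  by rewrite lead_coef_eq0 -size_poly_gt0 (ltn_trans _ f_nc).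
have [zs def_fc] := closed_field_poly_normal (f - c%:P).
rewrite lead_fc in def_fc.
have mem_zs a : (a \in zs) = (f.[a] == c).
  rewrite -root_prod_XsubC -(rootZ _ _ lead_neq0) -def_fc.
  by rewrite rootE !hornerE subr_eq0.
have perm_r : perm_eq (undup zs) r.
  apply: uniq_perm; rewrite ?undup_uniq // => a.
  by rewrite mem_undup mem_zs mem_r.
rewrite def_fc -prodr_undup_exp_count (perm_big _ perm_r) /=.
congr (_ *: _); apply: eq_big_seq => a; rewrite mem_r => /eqP f_a.
congr (_ ^+ _); rewrite /ram_index f_a def_fc -mul_polyC mupMr ?rootC //.
by rewrite mu_prod_XsubC.
Qed.

Lemma prod_fibers (R : comPzSemiRingType) (I J : eqType) (g : I -> J)
    (s : seq I) (F : I -> R) :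
  \prod_(a <- s) F a =
  \prod_(c <- undup (map g s)) \prod_(a <- s | g a == c) F a.
Proof.
rewrite [RHS](exchange_big_dep xpredT) //=; apply: eq_big_seq => a s_a.
under eq_bigl => c do rewrite eq_sym.
have g_a : g a \in undup (map g s) by rewrite mem_undup map_f.
by rewrite -big_filter (filter_pred1_uniq (undup_uniq _) g_a) big_seq1.
Qed.

(** The divisibility and constancy hypotheses say that the exponent is the
    pullback along [f] of a function [k] on values, times the ramification
    index; by [fiber_factorization] each fiber thus contributes a power of
    [(f - c) / lead_coef f]. *)
Lemma prod_saturated_is_comp (L : closedFieldType) (f : {poly L})
    (s : seq L) (n : L -> nat) :
  nonconstant f -> uniq s ->
  (forall a b, a \in s -> f.[b] = f.[a] -> b \in s) ->
  (forall a, a \in s -> (ram_index f a %| n a)%N) ->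
  (forall a b, a \in s -> b \in s -> f.[a] = f.[b] ->
     (n a %/ ram_index f a = n b %/ ram_index f b)%N) ->
  exists u, \prod_(a <- s) ('X - a%:P) ^+ n a = u \Po f.
Proof.
move=> f_nc s_uniq s_sat n_dvd n_eq.
(* rep c is the first point of s above the value c; it carries k c. *)
pose fs := map (horner f) s; pose rep c := nth 0 s (index c fs).
have rep_s c : c \in fs -> rep c \in s.
  by move=> c_fs; rewrite mem_nth // -(size_map (horner f)) index_mem.
have f_rep c : c \in fs -> f.[rep c] = c.
  move=> c_fs; rewrite -[LHS](nth_map 0 0 (horner f)) ?nth_index //.
  by rewrite -(size_map (horner f)) index_mem.
pose k c := (n (rep c) %/ ram_index f (rep c))%N.
exists (\prod_(c <- undup fs) ((lead_coef f)^-1 *: ('X - c%:P)) ^+ k c).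
rewrite rmorph_prod (prod_fibers (horner f)); apply: eq_big_seq => c.
rewrite mem_undup => c_fs.
have [rep_c f_c] := (rep_s c c_fs, f_rep c c_fs).
rewrite rmorphXn /= comp_polyZ comp_polyB comp_polyX comp_polyC.
rewrite (@fiber_factorization L f c [seq a <- s | f.[a] == c]) //; first last.
- move=> a; rewrite mem_filter andb_idr // => /eqP f_a.
  by apply: (s_sat (rep c)); rewrite // f_a f_c.
- exact: filter_uniq.
rewrite scalerA mulVf ?scale1r; last first.
  by rewrite lead_coef_eq0 -size_poly_gt0 (ltn_trans _ f_nc).
rewrite big_filter -prodrXl big_seq_cond [RHS]big_seq_cond.
apply: eq_bigr => a /andP[s_a /eqP f_a].
rewrite -exprM mulnC; congr (_ ^+ _).
rewrite /k (n_eq _ a) ?f_a ?f_c // divnK //; exact: n_dvd.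
Qed.

(** * Labeling polynomials *)

Lemma union_of_fibers_saturated (L : fieldType) (f : {poly L}) (A : set L)
    (a b : L) :
  is_union_of_fibers f A -> A a -> f.[b] = f.[a] -> A b.
Proof. by move=> [S ->] [c Sc /= f_a] f_b; exists c => //; rewrite /fiber /= f_b. Qed.

Lemma labeling_poly_seq (L : fieldType) (s : seq L) (l : L -> int) :
  uniq s -> (forall a, a \in s -> 0 < l a) ->
  labeling_poly [set` s] l = \prod_(a <- s) ('X - a%:P) ^+ `|l a|%N.
Proof.
move=> s_uniq l_gt0; rewrite /labeling_poly -fsbig_seq //.
by apply: eq_big_seq => a s_a; rewrite exprnP gez0_abs // ltW // l_gt0.
Qed.

Lemma labeling_poly_is_comp (L : closedFieldType) (f1 f2 f : {poly L})
    (A : set L) (l : L -> int) :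
  finite_set A -> consistent_labeling f1 f2 A l -> f = f1 \/ f = f2 ->
  is_union_of_fibers f A -> nonconstant f ->
  exists u, labeling_poly A l = u \Po f.
Proof.
move=> A_fin [l_dvd l_eq] f_f12 A_sat f_nc.
have [s0 def_A] := (finite_seqP A).1 A_fin.
pose s := undup s0.
have AP a : A a <-> a \in s by rewrite def_A mem_undup.
have -> : A = [set` s]%classic.
  by apply/seteqP; split=> a /= /AP.
have l_abs a : a \in s -> l a = `|l a|%N.
  by move=> /AP/l_dvd[la _ _]; rewrite gez0_abs // ltW.
have s_uniq : uniq s by exact: undup_uniq.
rewrite labeling_poly_seq //; last by move=> a /AP/l_dvd[].
apply: prod_saturated_is_comp => //.
- by move=> a b /AP Aa f_b; apply/AP; apply: union_of_fibers_saturated f_b.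
- by move=> a /AP/l_dvd[_]; rewrite !dvdzE /=; case: f_f12 => ->.
- move=> a b s_a s_b f_ab; have /AP Aa := s_a; have /AP Ab := s_b.
  have := l_eq f f_f12 a b Aa Ab f_ab.
  by rewrite (l_abs a) // (l_abs b) // !divz_nat => -[].
Qed.

Lemma labeling_poly_nonconstant (L : fieldType) (A : set L) (l : L -> int) :
  finite_set A -> (A !=set0)%classic -> (forall a, A a -> 0 < l a) ->
  nonconstant (labeling_poly A l).
Proof.
move=> /finite_seqP[s0 def_A] [a0 Aa0] l_gt0.
have AP a : A a <-> a \in undup s0 by rewrite def_A mem_undup.
have -> : A = [set` undup s0]%classic by apply/seteqP; split=> a /= /AP.
rewrite labeling_poly_seq ?undup_uniq //; last by move=> a /AP/l_gt0.
set p := \prod_(a <- _) _.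
have p_neq0 : p != 0.
  by apply: monic_neq0; apply: monic_prod => a _; rewrite monic_exp ?monicXsubC.
have p_a0 : root p a0.
  rewrite /p (bigD1_seq a0) ?undup_uniq //=; last exact/AP.
  have : (0 < `|l a0|)%N by rewrite absz_gt0 gt_eqF ?l_gt0.
  by case: `|l a0|%N => // n _; rewrite rootM root_exp_XsubC eqxx.
exact: root_size_gt1 p_neq0 p_a0.
Qed.

Theorem theorem7p4 (K : fieldType) (L : closedFieldType)
    (iota : {rmorphism K -> L}) (HL : is_algebraic_closure iota)
    (f1 f2 : {poly K}) (Hf1 : nonconstant f1) (Hf2 : nonconstant f2) :
  ((exists A : set L,
      compatible (map_poly iota f1) (map_poly iota f2) A /\
      consistent (map_poly iota f1) (map_poly iota f2) A) ->
   has_common_composite f1 f2) /\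
  (forall (A : set L) (l : L -> int),
     compatible (map_poly iota f1) (map_poly iota f2) A ->
     consistent_labeling (map_poly iota f1) (map_poly iota f2) A l ->
     is_common_composite (map_poly iota f1) (map_poly iota f2)
       (labeling_poly A l)).
Proof.
have map_nc f : nonconstant f -> nonconstant (map_poly iota f).
  by rewrite /nonconstant size_map_poly.
have composite (A : set L) (l : L -> int) :
    compatible (map_poly iota f1) (map_poly iota f2) A ->
    consistent_labeling (map_poly iota f1) (map_poly iota f2) A l ->
    is_common_composite (map_poly iota f1) (map_poly iota f2)
      (labeling_poly A l).
  move=> [A_neq0 A_fin A_sat1 A_sat2] l_cons.
  have l_gt0 a : A a -> 0 < l a by move=> /(l_cons.1 a)[].
  have h_nc := labeling_poly_nonconstant A_fin A_neq0 l_gt0.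
  have [u def_u] :=
    labeling_poly_is_comp A_fin l_cons (or_introl erefl) A_sat1 (map_nc _ Hf1).
  have [v def_v] :=
    labeling_poly_is_comp A_fin l_cons (or_intror erefl) A_sat2 (map_nc _ Hf2).
  exists u, v; split=> //.
  - by rewrite -(nonconstant_comp u (map_nc _ Hf1)) -def_u.
  - by rewrite -(nonconstant_comp v (map_nc _ Hf2)) -def_v.
split=> // -[A [A_comp [l l_cons]]].
apply: (@has_common_composite_map K L iota) => //.
by exists (labeling_poly A l); apply: composite.
Qed.
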